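(* The satisfiability problem for $\mathrm{LRP}$ formulas is undecidable: there is no algorithm that, given an $\mathrm{LRP}$ formula, decides whether some graph satisfies it.
   Context: A vocabulary is $\tau=\langle C,U,F\rangle$, where $C$ is a finite set of constant symbols, $U$ a set of unary relation symbols and $F$ a finite set of binary relation symbols (edge labels). A graph (interpretation) over $\tau$ is $G=\langle V,E,C^G,U^G\rangle$ with $V$ a set of nodes, $E(f)\subseteq V\times V$ for $f\in F$, $C^G(c)\in V$ for $c\in C$, and $U^G(u)\subseteq V$ for $u\in U$. Terms are variables or constants; atomic formulas are $t=t'$, $u(t)$ and $t\xrightarrow{f}t'$ (meaning $(t,t')\in E(f)$); quantifier-free formulas are Boolean combinations of atomic formulas. Routing expressions are given by the grammar $R::=\emptyset\mid\epsilon\mid \xrightarrow{f}\mid \xleftarrow{f}\mid u\mid\neg u\mid c\mid \neg c\mid R_1.R_2\mid R_1|R_2\mid R^*$ ($f\in F,u\in U,c\in C$), denoting a language $L(R)$ of words over the letters $\xrightarrow{f},\xleftarrow{f},u,\neg u,c,\neg c$. A path labelled by a word $w$ from node $a$ to node $b$ is defined by: $\epsilon$: $a=b$; $\xrightarrow{f}$: $(a,b)\in E(f)$; $\xleftarrow{f}$: $(b,a)\in E(f)$; $u$: $a=b\in U^G(u)$; $\neg u$: $a=b\notin U^G(u)$; $c$: $a=b=C^G(c)$; $\neg c$: $a=b\neq C^G(c)$; and a word $w_1w_2$ labels a path from $a$ to $b$ iff there is a node $d$ with a $w_1$-path from $a$ to $d$ and a $w_2$-path from $d$ to $b$. An $R$-path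 is a path labelled by some word of $L(R)$. A neighborhood formula $N(v_0,\dots,v_n)$ is a conjunction of edge atoms $v_i\xrightarrow{f}v_j$. A reachability constraint, written $[c,R]p$, is a closed formula $\forall v_0,\dots,v_n.\ R(c,v_0)\Rightarrow(N(v_0,\dots,v_n)\Rightarrow\psi(v_0,\dots,v_n))$ where $c\in C$, $R$ is a routing expression, $N$ is a neighborhood formula, $\psi$ is quantifier-free, the free variables of $N$ are among $v_0,\dots,v_n$ and those of $\psi$ are among $FV(N)\cup\{v_0\}$; $p(v_0):=N\Rightarrow\psi$ is its pattern. A graph $G$ satisfies it iff for every node $a$ reachable by an $R$-path from $C^G(c)$ and every assignment of nodes to $v_0,\dots,v_n$ with $v_0\mapsto a$, the assignment satisfies $N\Rightarrow\psi$. An $\mathrm{LRP}$ formula is a Boolean combination of reachability constraints, with the usual semantics of Boolean connectives. *)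

(* Defs.v *)
From mathcomp Require Import all_boot.
Set Implicit Arguments.
Unset Strict Implicit.
Unset Printing Implicit Defensive.

Record vocabulary := Vocabulary {
  cst : finType;
  una : Type;
  lab : finType }.

Record graph (tau : vocabulary) := Graph {
  node : Type;
  edge : lab tau -> node -> node -> Prop;
  icst : cst tau -> node;
  iuna : una tau -> node -> Prop }.

Inductive letter (tau : vocabulary) :=
  | Fwd of lab tau
  | Bwd of lab tau
  | Una of una tau
  | NotUna of una tau
  | Cst of cst tau
  | NotCst of cst tau.

Inductive routing (tau : vocabulary) :=
  | REmpty
  | REps
  | RLetter of letter tau
  | RCat of routing tau & routing tau
  | RAlt of routing tau & routing tau
  | RStar of routing tau.

Arguments REmpty {tau}.
Arguments REps {tau}.

Inductive star_lang (A : Type) (L : seq A -> Prop) : seq A -> Prop :=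
  | StarNil : star_lang L [::]
  | StarCat w1 w2 : L w1 -> star_lang L w2 -> star_lang L (w1 ++ w2).

Fixpoint lang tau (R : routing tau) : seq (letter tau) -> Prop :=
  match R with
  | REmpty => fun _ => False
  | REps => fun w => w = [::]
  | RLetter l => fun w => w = [:: l]
  | RCat R1 R2 => fun w => exists w1 w2, [/\ lang R1 w1, lang R2 w2 & w = w1 ++ w2]
  | RAlt R1 R2 => fun w => lang R1 w \/ lang R2 w
  | RStar R1 => star_lang (lang R1)
  end.

Definition letter_path tau (G : graph tau) (l : letter tau) (a b : node G) : Prop :=
  match l with
  | Fwd f => edge f a b
  | Bwd f => edge f b a
  | Una u => a = b /\ iuna u b
  | NotUna u => a = b /\ ~ iuna u b
  | Cst c => a = b /\ b = icst G c
  | NotCst c => a = b /\ b <> icst G c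
  end.

Fixpoint word_path tau (G : graph tau) (w : seq (letter tau)) (a b : node G) : Prop :=
  match w with
  | [::] => a = b
  | l :: w' => exists d, letter_path l a d /\ word_path w' d b
  end.

Definition routing_path tau (G : graph tau) (R : routing tau) (a b : node G) : Prop :=
  exists w, lang R w /\ word_path w a b.

(* Variables v_0, v_1, ... are represented by their indices. *)
Inductive term (tau : vocabulary) :=
  | TVar of nat
  | TCst of cst tau.

Arguments TVar {tau}.

Inductive qf (tau : vocabulary) :=
  | QEq of term tau & term tau
  | QUna of una tau & term tau
  | QEdge of lab tau & term tau & term tau
  | QNot of qf tau
  | QAnd of qf tau & qf tau
  | QOr of qf tau & qf tau.

Definition term_fv tau (t : term tau) : seq nat :=
  if t is TVar i then [:: i] else [::].

Fixpoint qf_fv tau (q : qf tau) : seq nat :=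
  match q with
  | QEq t t' => term_fv t ++ term_fv t'
  | QUna _ t => term_fv t
  | QEdge _ t t' => term_fv t ++ term_fv t'
  | QNot q1 => qf_fv q1
  | QAnd q1 q2 | QOr q1 q2 => qf_fv q1 ++ qf_fv q2
  end.

Definition term_val tau (G : graph tau) (s : nat -> node G) (t : term tau) : node G :=
  match t with TVar i => s i | TCst c => icst G c end.

Fixpoint qf_sat tau (G : graph tau) (s : nat -> node G) (q : qf tau) : Prop :=
  match q with
  | QEq t t' => term_val s t = term_val s t'
  | QUna u t => iuna u (term_val s t)
  | QEdge f t t' => edge f (term_val s t) (term_val s t')
  | QNot q1 => ~ qf_sat s q1
  | QAnd q1 q2 => qf_sat s q1 /\ qf_sat s q2
  | QOr q1 q2 => qf_sat s q1 \/ qf_sat s q2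
  end.

(* The triple (i, f, j) is the atom "v_i has an f-edge to v_j". *)
Definition neighborhood tau := seq (nat * lab tau * nat).

Definition nbh_fv tau (N : neighborhood tau) : seq nat :=
  flatten [seq [:: e.1.1; e.2] | e <- N].

Fixpoint nbh_sat tau (G : graph tau) (s : nat -> node G) (N : neighborhood tau) : Prop :=
  match N with
  | [::] => True
  | (i, f, j) :: N' => edge f (s i) (s j) /\ nbh_sat s N'
  end.

Record reach_constraint (tau : vocabulary) := ReachConstraint {
  rc_cst : cst tau;
  rc_routing : routing tau;
  rc_nbh : neighborhood tau;
  rc_body : qf tau;
  rc_fv : all [in 0 :: nbh_fv rc_nbh] (qf_fv rc_body) }.

Definition rc_sat tau (G : graph tau) (k : reach_constraint tau) : Prop :=
  forall s : nat -> node G,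
    routing_path (rc_routing k) (icst G (rc_cst k)) (s 0) ->
    nbh_sat s (rc_nbh k) -> qf_sat s (rc_body k).

Inductive LRP (tau : vocabulary) :=
  | LReach of reach_constraint tau
  | LNot of LRP tau
  | LAnd of LRP tau & LRP tau
  | LOr of LRP tau & LRP tau.

Fixpoint LRP_sat tau (G : graph tau) (phi : LRP tau) : Prop :=
  match phi with
  | LReach k => rc_sat G k
  | LNot phi1 => ~ LRP_sat G phi1
  | LAnd phi1 phi2 => LRP_sat G phi1 /\ LRP_sat G phi2
  | LOr phi1 phi2 => LRP_sat G phi1 \/ LRP_sat G phi2
  end.

Definition LRP_satisfiable tau (phi : LRP tau) : Prop :=
  exists G : graph tau, LRP_sat G phi.

(* Inputs of the decision problem: up to renaming of symbols, every formula is
   over a vocabulary of this form. *)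
Definition std_vocabulary (nc nf : nat) : vocabulary :=
  Vocabulary 'I_nc nat 'I_nf.

Record LRP_instance := LRPInstance {
  ncst : nat;
  nlab : nat;
  formula : LRP (std_vocabulary ncst nlab) }.

(* Goedel numbering, from the Cantor pairing. *)
Definition cpair (a b : nat) : nat := ((a + b) * (a + b).+1)./2 + b.

Fixpoint code_seq (s : seq nat) : nat :=
  if s is x :: s' then (cpair x (code_seq s')).+1 else 0.

Section Code.
Context (nc nf : nat).
Let tau := std_vocabulary nc nf.

Definition code_letter (l : letter tau) : nat :=
  match l with
  | Fwd f => cpair 0 (f : 'I_nf)
  | Bwd f => cpair 1 (f : 'I_nf)
  | Una u => cpair 2 u
  | NotUna u => cpair 3 u
  | Cst c => cpair 4 (c : 'I_nc)
  | NotCst c => cpair 5 (c : 'I_nc)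
  end.

Fixpoint code_routing (R : routing tau) : nat :=
  match R with
  | REmpty => cpair 0 0
  | REps => cpair 1 0
  | RLetter l => cpair 2 (code_letter l)
  | RCat R1 R2 => cpair 3 (cpair (code_routing R1) (code_routing R2))
  | RAlt R1 R2 => cpair 4 (cpair (code_routing R1) (code_routing R2))
  | RStar R1 => cpair 5 (code_routing R1)
  end.

Definition code_term (t : term tau) : nat :=
  match t with
  | TVar i => cpair 0 i
  | TCst c => cpair 1 (c : 'I_nc)
  end.

Fixpoint code_qf (q : qf tau) : nat :=
  match q with
  | QEq t t' => cpair 0 (cpair (code_term t) (code_term t'))
  | QUna u t => cpair 1 (cpair u (code_term t))
  | QEdge f t t' => cpair 2 (cpair (f : 'I_nf) (cpair (code_term t) (code_term t')))
  | QNot q1 => cpair 3 (code_qf q1)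
  | QAnd q1 q2 => cpair 4 (cpair (code_qf q1) (code_qf q2))
  | QOr q1 q2 => cpair 5 (cpair (code_qf q1) (code_qf q2))
  end.

Definition code_nbh (N : neighborhood tau) : nat :=
  code_seq [seq cpair e.1.1 (cpair (e.1.2 : 'I_nf) e.2) | e <- N].

Definition code_rc (k : reach_constraint tau) : nat :=
  cpair (rc_cst k : 'I_nc) (cpair (code_routing (rc_routing k))
    (cpair (code_nbh (rc_nbh k)) (code_qf (rc_body k)))).

Fixpoint code_LRP (phi : LRP tau) : nat :=
  match phi with
  | LReach k => cpair 0 (code_rc k)
  | LNot phi1 => cpair 1 (code_LRP phi1)
  | LAnd phi1 phi2 => cpair 2 (cpair (code_LRP phi1) (code_LRP phi2))
  | LOr phi1 phi2 => cpair 3 (cpair (code_LRP phi1) (code_LRP phi2))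
  end.

End Code.

Definition code_instance (x : LRP_instance) : nat :=
  cpair (ncst x) (cpair (nlab x) (code_LRP (formula x))).

Lemma cpair_inj a b a' b' : cpair a b = cpair a' b' -> a = a' /\ b = b'.
Proof.
have T n : (n.+1 * n.+2)./2 = (n * n.+1)./2 + n.+1.
  by rewrite (mulnC n.+1) (mulnC n) -(bin2 n.+2) -(bin2 n.+1) binS bin1.
have mono m n : m <= n -> (m * m.+1)./2 <= (n * n.+1)./2.
  by move=> le_mn; rewrite half_leq // leq_mul.
have lt c d c' d' : c + d < c' + d' -> cpair c d < cpair c' d'.
  move=> /mono; rewrite T /cpair => le.
  by apply: leq_trans (leq_addr _ _); apply: leq_trans le;
     rewrite ltn_add2l ltnS leq_addl.
move=> e; have es : a + b = a' + b'.
  by case: (ltngtP (a + b) (a' + b')) => // /lt; rewrite e ltnn.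
move: e; rewrite /cpair es => /addnI eb; move: es; rewrite eb => /addIn ea.
by [].
Qed.

Lemma code_seq_inj : injective code_seq.
Proof.
elim=> [|x s IH] [|y t] //= [] /cpair_inj [-> /IH ->] //.
Qed.

Lemma code_letter_inj nc nf : injective (@code_letter nc nf).
Proof.
by case=> x [] y /cpair_inj [//= _]; [move/val_inj=> -> | move/val_inj=> -> |
  move=> -> | move=> -> | move/val_inj=> -> | move/val_inj=> ->].
Qed.

Lemma code_routing_inj nc nf : injective (@code_routing nc nf).
Proof.
elim=> [||l|R1 IH1 R2 IH2|R1 IH1 R2 IH2|R1 IH1] [||l'|Q1 Q2|Q1 Q2|Q1] //=
  /cpair_inj [//= _].
- by move/code_letter_inj=> ->.
- by move/cpair_inj=> [/IH1 -> /IH2 ->].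
- by move/cpair_inj=> [/IH1 -> /IH2 ->].
- by move/IH1=> ->.
Qed.

Lemma code_term_inj nc nf : injective (@code_term nc nf).
Proof.
by case=> x [] y /cpair_inj [//= _]; [move=> -> | move/val_inj=> ->].
Qed.

Lemma code_qf_inj nc nf : injective (@code_qf nc nf).
Proof.
elim=> [t1 t2|u t|f t1 t2|q1 IH1|q1 IH1 q2 IH2|q1 IH1 q2 IH2]
  [s1 s2|v s|g s1 s2|r1|r1 r2|r1 r2] //= /cpair_inj [//= _].
- by move/cpair_inj=> [/code_term_inj -> /code_term_inj ->].
- by move/cpair_inj=> [-> /code_term_inj ->].
- by move/cpair_inj=> [/val_inj -> /cpair_inj [/code_term_inj -> /code_term_inj ->]].
- by move/IH1=> ->.
- by move/cpair_inj=> [/IH1 -> /IH2 ->].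
- by move/cpair_inj=> [/IH1 -> /IH2 ->].
Qed.

Lemma code_nbh_inj nc nf : injective (@code_nbh nc nf).
Proof.
move=> N N' /code_seq_inj; apply: inj_map => -[[i f] j] [[i' f'] j'] /=.
by move/cpair_inj=> [-> /cpair_inj [/val_inj -> ->]].
Qed.

Lemma code_rc_inj nc nf : injective (@code_rc nc nf).
Proof.
case=> c R N q fv [c' R' N' q' fv'] /cpair_inj /= [/val_inj ec].
move/cpair_inj=> [/code_routing_inj eR /cpair_inj [/code_nbh_inj eN /code_qf_inj eq]].
by move: fv fv'; rewrite ec eR eN eq => fv fv'; rewrite (bool_irrelevance fv fv').
Qed.

Lemma code_LRP_inj nc nf : injective (@code_LRP nc nf).
Proof.
elim=> [k|p1 IH1|p1 IH1 p2 IH2|p1 IH1 p2 IH2] [k'|q1|q1 q2|q1 q2] //=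
  /cpair_inj [//= _].
- by move/code_rc_inj=> ->.
- by move/IH1=> ->.
- by move/cpair_inj=> [/IH1 -> /IH2 ->].
- by move/cpair_inj=> [/IH1 -> /IH2 ->].
Qed.

Lemma code_instance_inj : injective code_instance.
Proof.
case=> nc nf phi [nc' nf' phi'] /cpair_inj /= [ec] /cpair_inj [ef].
by case: nc' / ec phi' => phi'; case: nf' / ef phi' => phi' /code_LRP_inj ->.
Qed.

(* Partial recursive functions of n arguments. *)
Inductive murec : nat -> Type :=
  | MZero n : murec n
  | MSucc : murec 1
  | MProj n : 'I_n -> murec n
  | MComp m n : murec m -> ('I_m -> murec n) -> murec n
  | MPrec n : murec n -> murec n.+2 -> murec n.+1
  | MMu n : murec n.+1 -> murec n.

(* [murec_eval p v y]: p is defined on v, with value y.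
   Primitive recursion is on the first argument: h(0, v) = f(v) and
   h(i + 1, v) = g(i, h(i, v), v); in the clause, s i is h(i, v).
   Minimization returns the least y with f(y, v) = 0, all the f(z, v), z < y,
   being defined. *)
Fixpoint murec_eval n (p : murec n) : n.-tuple nat -> nat -> Prop :=
  match p in murec n return n.-tuple nat -> nat -> Prop with
  | MZero n => fun v y => y = 0
  | MSucc => fun v y => y = (thead v).+1
  | MProj n i => fun v y => y = tnth v i
  | MComp m n f g => fun v y =>
      exists w : m.-tuple nat,
        (forall i, murec_eval (g i) v (tnth w i)) /\ murec_eval f w y
  | MPrec n f g => fun v y =>
      exists s : nat -> nat,
        [/\ murec_eval f [tuple of behead v] (s 0),
            forall i, i < thead v ->
              murec_eval g [tuple of i :: s i :: behead v] (s i.+1)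
          & y = s (thead v)]
  | MMu n f => fun v y =>
      murec_eval f [tuple of y :: v] 0 /\
      forall z, z < y -> exists k, murec_eval f [tuple of z :: v] k.+1
  end.

Lemma murec_eval_functional n (p : murec n) v y y' :
  murec_eval p v y -> murec_eval p v y' -> y = y'.
Proof.
elim: p v y y' => {n} [n|| n i|m n f IHf g IHg|n f IHf g IHg|n f IHf] v y y' /=;
  try by move=> -> ->.
- move=> [w [gw fw]] [w' [gw' fw']]; apply: IHf fw _.
  suff -> : w = w' by [].
  by apply: eq_from_tnth => i; apply: IHg (gw i) (gw' i).
- move=> [s [s0 sS ->]] [s' [s0' sS' ->]].
  have: thead v <= thead v by [].
  move: {1 3 4}(thead v); elim=> [_|i IH lt_i]; first exact: IHf s0 s0'.
  have e := IH (ltnW lt_i); apply: IHg (sS _ lt_i) _.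
  by rewrite e; apply: sS'.
- move=> [fy ltf] [fy' ltf']; case: (ltngtP y y') => // lt.
  + by have [k /(IHf _ _ _ fy)] := ltf' _ lt.
  + by have [k /(IHf _ _ _ fy')] := ltf _ lt.
Qed.

(* Deciders are only constrained on codes of elements of A. *)
Definition algorithmically_decidable (A : Type) (code : A -> nat) (P : A -> Prop) : Prop :=
  exists d : murec 1, forall x : A,
    (P x -> murec_eval d [tuple code x] 1) /\
    (~ P x -> murec_eval d [tuple code x] 0).

(* Main.v *)
From Stdlib Require Import FunctionalExtensionality Classical.
Require Import Defs.
From mathcomp Require Import all_boot zify.

Set Implicit Arguments.
Unset Strict Implicit.
Unset Printing Implicit Defensive.

(** A routing expression is a program: over the letters "increment", "decrement"
    and "test for zero" of finitely many registers, the words of a regular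
    expression are the traces of a while program, and every partial recursive
    function is computed by such a program. Executions live on a grid whose
    columns are the times and whose rows are the numbers, with one mark per
    column and register. Positive reachability constraints make the graph
    locally a grid and the marks unique; a negated one demands a path from the
    origin that performs an execution of the program and, at each step, walks up
    the next column and checks its marks against the previous one. Hence the
    formula of a program, together with the constraint "register 0 starts with
    n", is satisfiable iff the program halts on n.

    The unary symbols being unlimited, the numbers of constants and of labels do
    not depend on the program. So a decision procedure yields a partial
    recursive h that halts on the code of a formula phi iff phi with its own
    code as input is unsatisfiable; the formula of a program for h is then a
    contradiction. *)

(** * Register programs for partial recursive functions *)

Inductive star (T : Type) (r : T -> T -> Prop) : T -> T -> Prop :=
  | StarRefl x : star r x x
  | StarStep x y z : r x y -> star r y z -> star r x z.

Definition store := nat -> nat.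

Definition upd (s : store) q v : store := fun r => if r == q then v else s r.

Inductive instr := Inc of nat | Dec of nat | Tz of nat.

(* Executing an instruction writes each register as v + pre before and as
   v + post after; tz forces v = 0. *)
Definition pre i r := if i is Dec q then r == q else false.
Definition post i r := if i is Inc q then r == q else false.
Definition tz i r := if i is Tz q then r == q else false.

Definition step i (s s' : store) : Prop := forall r, exists v,
  [/\ s r = v + pre i r, s' r = v + post i r & tz i r -> v = 0].

(** [Star] repeats any finite number of times and there is no branching. Control comes from
    blocking: [Dec] has no outcome at 0 and [Tz] has none off 0. *)
Inductive prog :=
  | Skip
  | Atom of instr
  | Seq of prog & prog
  | Star of prog.

Fixpoint exec P : store -> store -> Prop :=
  match P with
  | Skip => fun s s' => s' = s
  | Atom i => step i
  | Seq P Q => fun s s' => exists2 m, exec P s m & exec Q m s'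
  | Star P => star (exec P)
  end.

Lemma exec_seq P Q s s' :
  exec (Seq P Q) s s' <-> exists2 m, exec P s m & exec Q m s'.
Proof. by []. Qed.

Lemma exec_inc q s s' : exec (Atom (Inc q)) s s' <-> s' = upd s q (s q).+1.
Proof.
split=> [st|->].
  apply: functional_extensionality => r; have [v [/=]] := st r; rewrite /upd.
  by case: eqP => [->|_] /=; lia.
by move=> r; exists (s r); rewrite /= /upd; case: eqP => [->|]; split; lia.
Qed.

Lemma exec_dec q s s' :
  exec (Atom (Dec q)) s s' <-> 0 < s q /\ s' = upd s q (s q).-1.
Proof.
split=> [st|[s_gt0 ->]].
  split; first by have [v [/=]] := st q; rewrite eqxx; lia.
  apply: functional_extensionality => r; have [v [/=]] := st r; rewrite /upd.
  by case: eqP => [->|_] /=; lia.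
move=> r; exists (s r - (r == q)); rewrite /= /upd.
by case: eqP => [->|]; split; lia.
Qed.

Lemma exec_tz q s s' : exec (Atom (Tz q)) s s' <-> s q = 0 /\ s' = s.
Proof.
split=> [st|[s0 ->]].
  split; first by have [v [/=]] := st q; rewrite eqxx; lia.
  by apply: functional_extensionality => r; have [v [/=]] := st r; lia.
by move=> r; exists (s r); rewrite /=; case: eqP => [->|]; split; lia.
Qed.

(** * Counting loops and transfers between registers *)

Definition loop q P := Seq (Star (Seq (Atom (Dec q)) P)) (Atom (Tz q)).

Lemma exec_loop0 q P s s' : s q = 0 -> exec (loop q P) s s' <-> s' = s.
Proof.
move=> s0; split=> [|->].
  case/exec_seq=> m st /exec_tz [_ ->]; case: st s0 => // x y z.
  by case=> m' /exec_dec [x_gt0 _] _ _ x0; rewrite x0 in x_gt0.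
by exists s; [exact: StarRefl | apply/exec_tz].
Qed.

(** With [q] positive the closing [Tz q] blocks an exit, so another round is forced although [Star]
    itself is nondeterministic. *)
Lemma exec_loopS q P s s' n : s q = n.+1 ->
  exec (loop q P) s s' <->
  exists2 m, exec P (upd s q n) m & exec (loop q P) m s'.
Proof.
move=> sn; split.
  case/exec_seq=> m st /exec_tz [m0 ->]; case: st sn m0 => [x -> //|x y z].
  case=> m' /exec_dec [_ ->] ex st xn z0; rewrite xn in ex.
  by exists y => //; exists z => //; apply/exec_tz.
case=> m ex [m' st tz0]; exists m' => //; apply: StarStep st.
by exists (upd s q n) => //; apply/exec_dec; rewrite sn.
Qed.

Definition incs qs := foldr (fun q => Seq (Atom (Inc q))) Skip qs.

Lemma exec_incs (qs : seq nat) s s' : uniq qs ->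
  exec (incs qs) s s' <-> s' = fun r => if r \in qs then (s r).+1 else s r.
Proof.
elim: qs s s' => [|q qs IH] s s' /=; first by move=> _; split=> ->.
case/andP=> qqs uqs.
have E : (fun r => if r \in qs then (upd s q (s q).+1 r).+1
          else upd s q (s q).+1 r)
         = (fun r => if r \in q :: qs then (s r).+1 else s r).
  apply: functional_extensionality => r; rewrite inE /upd.
  by case: eqP => [->|]; rewrite ?(negPf qqs).
split=> [[m /exec_inc -> H]|->]; first by rewrite -E; apply/(IH _ _ uqs).
by exists (upd s q (s q).+1); [apply/exec_inc | apply/(IH _ _ uqs); rewrite E].
Qed.

Ltac regs := do !(case: eqP => ? /=); subst; try lia.

Definition drain q qs := loop q (incs qs).

Lemma exec_drain (q : nat) (qs : seq nat) s s' : uniq qs -> q \notin qs ->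
  exec (drain q qs) s s' <->
  s' = fun r => if r == q then 0 else if r \in qs then s r + s q else s r.
Proof.
move=> uqs qqs; move: {2}(s q) (erefl (s q)) => n; elim: n s => [|n IH] s sn.
  rewrite exec_loop0 //; suff -> : (fun r => if r == q then 0 else
    if r \in qs then s r + s q else s r) = s by [].
  apply: functional_extensionality => r; rewrite sn addn0.
  by case: eqP => [->|_] //; case: ifP.
rewrite (exec_loopS _ _ sn).
set m : store := fun r : nat => if r \in qs then (upd s q n r).+1 else upd s q n r.
have mq : m q = n by rewrite /m (negPf qqs) /upd eqxx.
have -> : (exists2 m', exec (incs qs) (upd s q n) m' & exec (drain q qs) m' s')
          <-> exec (drain q qs) m s'.
  split=> [[m' /exec_incs-/(_ uqs) -> //]|ex].
  by exists m => //; rewrite exec_incs.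
rewrite IH //; suff -> : (fun r => if r == q then 0 else
    if r \in qs then m r + m q else m r) = (fun r => if r == q then 0 else
    if r \in qs then s r + s q else s r) by [].
apply: functional_extensionality => r; rewrite mq sn /m /upd.
by case: eqP => // _; case: ifP => H; rewrite ?H; lia.
Qed.

(** Reading a register empties it: [x] is drained into both the target [q] and the scratch [z], and
    [z] is then drained back into [x]. *)
Definition copy x q z := Seq (drain x [:: q; z]) (drain z [:: x]).

Lemma exec_copy (x q z : nat) (s s' : store) :
  x != q -> x != z -> q != z -> s z = 0 ->
  exec (copy x q z) s s' <-> s' = upd s q (s q + s x).
Proof.
move=> xq xz qz sz.
have u : uniq [:: q; z] by rewrite /= inE qz.
have n1 : x \notin [:: q; z] by rewrite !inE (negPf xq).
have n2 : z \notin [:: x] by rewrite inE eq_sym.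
split.
  case/exec_seq=> m /exec_drain-/(_ u n1) -> /exec_drain-/(_ isT n2) ->.
  apply: functional_extensionality => r; rewrite /upd !inE.
  by regs.
move=> ->; set m := (fun r => if r == x then 0
  else if r \in [:: q; z] then s r + s x else s r).
apply/exec_seq; exists m; first by rewrite exec_drain.
rewrite exec_drain //; apply: functional_extensionality => r.
by rewrite /m /upd !inE; regs.
Qed.

Fixpoint clear t m :=
  if m is j.+1 then Seq (clear t j) (drain (t + j) [::]) else Skip.

Lemma exec_clear t m s s' :
  exec (clear t m) s s' <-> s' = fun r => if t <= r < t + m then 0 else s r.
Proof.
elim: m s s' => [|j IH] s s'.
  rewrite /=; suff -> : (fun r => if t <= r < t + 0 then 0 else s r) = s by [].
  by apply: functional_extensionality => r; case: ifP => //; lia.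
have E : (fun r => if r == t + j then 0 else if t <= r < t + j then 0 else s r)
  = (fun r => if t <= r < t + j.+1 then 0 else s r).
  by apply: functional_extensionality => r; do !case: ifP => //; lia.
split=> [/exec_seq [m /IH -> /exec_drain-/(_ isT isT) ->] //|->].
by apply/exec_seq; eexists; [exact/IH | by rewrite exec_drain // -E].
Qed.

(** * Compilation of partial recursive functions *)

Definition args n (F : nat -> nat) : n.-tuple nat := [tuple F i | i < n].

Lemma eq_args n F F' : (forall i, i < n -> F i = F' i) -> args n F = args n F'.
Proof. by move=> e; apply: eq_from_tnth => i; rewrite !tnth_mktuple e. Qed.

Lemma thead_args n F : thead (args n.+1 F) = F 0.
Proof. by rewrite /thead tnth_mktuple. Qed.

Lemma behead_args n F :
  [tuple of behead (args n.+1 F)] = args n (fun i => F i.+1).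
Proof.
by apply: val_inj; rewrite /= enum_ordSl /= -map_comp; apply: eq_map.
Qed.

Definition scons x (F : nat -> nat) i := if i is j.+1 then F j else x.

Lemma cons_args n x F : [tuple of x :: args n F] = args n.+1 (scons x F).
Proof.
by apply: val_inj; rewrite /= enum_ordSl /= -map_comp; congr cons; apply: eq_map.
Qed.

(* Registers from t on are free: they hold 0 before and after. *)
Definition implements n (p : murec n) (a : nat -> nat) o t P :=
  forall s s', (forall r, t <= r -> s r = 0) -> s o = 0 ->
  exec P s s' <->
  exists2 y, murec_eval p (args n (fun i => s (a i))) y & s' = upd s o y.

(** The free choice of argument registers, output and scratch bound is what lets compiled pieces be
    nested without clashes. *)
Definition compilable n (p : murec n) := forall a (o t : nat),
  (forall i, i < n -> a i < t) -> (forall i, i < n -> a i != o) -> o < t ->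
  exists P, implements p a o t P.

Lemma upd_id s q : upd s q (s q) = s.
Proof.
by apply: functional_extensionality => r; rewrite /upd; case: eqP => [->|].
Qed.

Lemma compile_zero n : compilable (MZero n).
Proof.
move=> a o t _ _ _; exists Skip => s s' _ so /=; split=> [->|[y -> ->]].
  by exists 0; rewrite // -so upd_id.
by rewrite -so upd_id.
Qed.

Lemma compile_proj n (i : 'I_n) : compilable (MProj i).
Proof.
move=> a o t lt_a ne_a lt_o; exists (copy (a i) o t) => s s' st so.
have := lt_a _ (ltn_ord i); have := ne_a _ (ltn_ord i) => ne lt.
rewrite exec_copy ?(st t) ?so ?add0n //; try lia.
split=> [->|[y]] /=; first by exists (s (a i)); rewrite ?tnth_mktuple.
by rewrite tnth_mktuple => -> ->.
Qed.

Lemma compile_succ : compilable MSucc.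
Proof.
move=> a o t lt_a ne_a lt_o; exists (Seq (copy (a 0) o t) (Atom (Inc o))).
move=> s s' st so; have lt := lt_a 0 isT; have ne := ne_a 0 isT.
have E : upd (upd s o (s o + s (a 0))) o (upd s o (s o + s (a 0)) o).+1
         = upd s o (s (a 0)).+1.
  by apply: functional_extensionality => r; rewrite /upd eqxx so; case: eqP.
split=> [/exec_seq [m /exec_copy E1 /exec_inc ->]|[y + ->]].
  by rewrite /= thead_args E1 ?E ?(st t) //; try lia; eexists.
rewrite [X in X -> _]/= thead_args => ->; rewrite -E; apply/exec_seq.
eexists; last exact/exec_inc.
by rewrite exec_copy ?(st t) //; lia.
Qed.

(** Register [t + j] receives the value of [g j], [f] reads these registers, and they are cleared at
    the end. All pieces take their scratch from [t + m] on. *)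
Lemma compile_comp m n (f : murec m) (g : 'I_m -> murec n) :
  compilable f -> (forall i, compilable (g i)) -> compilable (MComp f g).
Proof.
move=> Cf Cg a o t lt_a ne_a lt_o.
pose put j (w : nat -> nat) (s : store) : store :=
  fun r => if t <= r < t + j then w (r - t) else s r.
have put_arg j w s i : i < n -> put j w s (a i) = s (a i).
  by move=> /lt_a; rewrite /put => ?; case: ifP => //; lia.
(* Induction on the number [j] of inner functions already evaluated; [w] collects their values. *)
have stages : forall j, j <= m -> exists P, forall s s',
    (forall r, t <= r -> s r = 0) -> exec P s s' <->
    exists2 w : nat -> nat, forall i : 'I_m, i < j ->
      murec_eval (g i) (args n (fun i => s (a i))) (w i) & s' = put j w s.
  elim=> [_|j IH lt_j].
    have E w s : put 0 w s = s.
      by apply: functional_extensionality => r; rewrite /put; case: ifP => //; lia.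
    exists Skip => s s' _ /=; split=> [->|[w _]]; last by rewrite E.
    by exists (fun=> 0); rewrite ?E.
  have [P HP] := IH (ltnW lt_j).
  have [|||Q HQ] := Cg (Ordinal lt_j) a (t + j) (t + m); try lia.
  - by move=> i /lt_a; lia.
  - by move=> i /lt_a; lia.
  have HQ' w s s' : (forall r, t <= r -> s r = 0) -> exec Q (put j w s) s' <->
      exists2 y, murec_eval (g (Ordinal lt_j)) (args n (fun i => s (a i))) y
      & s' = upd (put j w s) (t + j) y.
    move=> st; rewrite HQ.
    - by rewrite (eq_args (put_arg j w s)).
    - by move=> r le_r; rewrite /put ifF ?st //; lia.
    - by rewrite /put ifF ?st //; lia.
  exists (Seq P Q) => s s' st; split.
    case/exec_seq=> m1 /(HP _ _ st) [w Hw ->] /(HQ' _ _ _ st) [y Hy ->].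
    exists (upd w j y).
      move=> i; rewrite ltnS leq_eqVlt => /orP [/eqP e|lt_i].
        rewrite /upd e eqxx; suff -> : i = Ordinal lt_j by [].
        exact: val_inj.
      by rewrite /upd ltn_eqF //; apply: Hw.
    apply: functional_extensionality => r; rewrite /upd /put.
    case: eqP => [->|ne]; first by rewrite ifT ?ifT //; lia.
    case: ifP => [H|]; last by case: ifP => //; lia.
    by rewrite ifT ?ifF //; lia.
  case=> w Hw ->; apply/exec_seq; exists (put j w s).
    by apply/HP => //; exists w => // i lt_i; apply: Hw; lia.
  apply/HQ' => //; exists (w j); first exact: (Hw (Ordinal lt_j)).
  apply: functional_extensionality => r; rewrite /upd /put.
  case: eqP => [->|ne]; first by rewrite ifT ?addKn //; lia.
  by do !case: ifP => //; lia.
have [P HP] := stages m (leqnn m).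
have [|||Q HQ] := Cf (fun i => t + i) o (t + m); try lia.
exists (Seq P (Seq Q (clear t m))) => s s' st so.
have HQ' w s1 : exec Q (put m w s) s1 <->
    exists2 y, murec_eval f (args m w) y & s1 = upd (put m w s) o y.
  rewrite HQ.
  - rewrite (@eq_args m (fun i => put m w s (t + i)) w) //.
    by move=> i lt_i; rewrite /put ifT ?addKn //; lia.
  - by move=> r le_r; rewrite /put ifF ?st //; lia.
  - by rewrite /put ifF ?so //; lia.
have E w y : (fun r => if t <= r < t + m then 0 else upd (put m w s) o y r)
    = upd s o y.
  apply: functional_extensionality => r; rewrite /upd /put.
  case: eqP => [->|_]; first by rewrite ifF //; lia.
  by case: ifP => H; rewrite ?H // st //; lia.
split.
  case/exec_seq=> m1 /(HP _ _ st) [w Hw ->].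
  case/exec_seq=> m2 /HQ' [y Hy ->] /exec_clear ->.
  exists y => /=; last by rewrite E.
  exists (args m w); split=> // i; rewrite tnth_mktuple; exact: Hw.
case=> y [w [Hw Hy]] ->; pose w' i := nth 0 w i.
apply/exec_seq; exists (put m w' s).
  by apply/HP => //; exists w' => // i _; have := Hw i; rewrite (tnth_nth 0).
apply/exec_seq; exists (upd (put m w' s) o y); last by apply/exec_clear; rewrite E.
apply/HQ'; exists y => //; suff -> : args m w' = w by [].
by apply: eq_from_tnth => i; rewrite tnth_mktuple /w' -tnth_nth.
Qed.

Lemma compile_prec n (f : murec n) (g : murec n.+2) :
  compilable f -> compilable g -> compilable (MPrec f g).
Proof.
move=> Cf Cg a o t lt_a ne_a lt_o.
(* t counts down, t+1 counts up, t+2 holds the current value of the recursion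
   and t+3 receives the next one. *)
pose st (s : store) c i u : store := fun r =>
  if r == t then c else if r == t.+1 then i else if r == t.+2 then u else s r.
(* The arguments of [g]: index, previous value, parameters. The shift in [a] skips argument 0, the
   recursion bound. *)
pose b := scons t.+1 (scons t.+2 (fun i => a i.+1)).
have [|||F HF] := Cf (fun i => a i.+1) t.+2 t.+4; try lia.
- by move=> i lt_i; have := lt_a i.+1; lia.
- by move=> i lt_i; have := lt_a i.+1; lia.
have [|||G HG] := Cg b t.+3 t.+4; try lia.
- by case=> [|[|i]] lt_i /=; try lia; have := lt_a i.+1; lia.
- by case=> [|[|i]] lt_i /=; try lia; have := lt_a i.+1; lia.
pose body := Seq G (Seq (drain t.+2 [::]) (Seq (drain t.+3 [:: t.+2])
  (Atom (Inc t.+1)))).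
exists (Seq F (Seq (copy (a 0) t t.+4) (Seq (loop t body)
  (Seq (drain t.+2 [:: o]) (drain t.+1 [::]))))) => s s' s0 so.
set v := args n.+1 _; pose rest := [tuple of behead v].
have arest : rest = args n (fun i => s (a i.+1)) by exact: behead_args.
have x3 : t.+3 \notin [:: t.+2] by rewrite inE; lia.
have HG' c i u m : exec G (st s c i u) m <->
    exists2 y, murec_eval g [tuple of i :: u :: behead v] y
    & m = upd (st s c i u) t.+3 y.
  rewrite HG.
  - rewrite (_ : args _ _ = [tuple of i :: u :: behead v]) //.
    have -> : [tuple of i :: u :: behead v] = [tuple of i :: [tuple of u :: rest]].
      exact: val_inj.
    rewrite arest !cons_args; apply: eq_args => -[|[|j]] lt_j; rewrite /b /st /=.
    + by regs.
    + by regs.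
    + by have := lt_a j.+1 lt_j; regs.
  - by move=> r le_r; rewrite /st; regs; rewrite s0 //; lia.
  - by rewrite /st; regs; rewrite s0 //; lia.
(* The right side is literally the store left by the two drains and the increment once [y] is in
   [t + 3]. *)
have E c i u y : st s c i.+1 y = upd (fun r => if r == t.+3 then 0 else
    if r \in [:: t.+2] then (fun r => if r == t.+2 then 0 else
      upd (st s c i u) t.+3 y r) r + (fun r => if r == t.+2 then 0 else
      upd (st s c i u) t.+3 y r) t.+3 else (fun r => if r == t.+2 then 0 else
      upd (st s c i u) t.+3 y r) r) t.+1 i.+1.
  apply: functional_extensionality => r; rewrite /upd /st !inE.
  regs; rewrite s0 //; lia.
have Hbody c i u m : exec body (st s c i u) m <->
    exists2 y, murec_eval g [tuple of i :: u :: behead v] y & m = st s c i.+1 y.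
  split.
    case/exec_seq=> m1 /HG' [y Hy ->] /exec_seq [m2 /exec_drain-/(_ isT isT) ->].
    case/exec_seq=> m3 /exec_drain-/(_ isT x3) -> /exec_inc ->.
    exists y => //; rewrite (E c i u); congr upd; congr S.
    by rewrite /upd /st !inE; regs.
  case=> y Hy ->; apply/exec_seq; exists (upd (st s c i u) t.+3 y).
    by apply/HG'; exists y.
  apply/exec_seq; eexists; first by rewrite exec_drain.
  apply/exec_seq; eexists; first by rewrite exec_drain.
  apply/exec_inc; rewrite (E c i u); congr upd; congr S.
  by rewrite /upd /st !inE; regs.
(* Index [i] and value [u] are arbitrary because each round changes both, while the induction is on
   the countdown [c]. *)
have Hloop c i u m : exec (loop t body) (st s c i u) m <->
    exists2 w : nat -> nat, w 0 = u /\ (forall j, j < c ->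
      murec_eval g [tuple of i + j :: w j :: behead v] (w j.+1))
    & m = st s 0 (i + c) (w c).
  elim: c i u m => [|c IH] i u m.
    rewrite exec_loop0; last by rewrite /st eqxx.
    split=> [->|[w [w0 _] ->]]; last by rewrite addn0 w0.
    by exists (fun=> u); rewrite ?addn0.
  rewrite (@exec_loopS _ _ _ _ c); last by rewrite /st eqxx.
  have -> : upd (st s c.+1 i u) t c = st s c i u.
    by apply: functional_extensionality => r; rewrite /upd /st; case: eqP.
  split.
    case=> m1 /Hbody [y Hy ->] /IH [w [w0 Hw] ->].
    exists (scons u w); last by rewrite addSnnS.
    split=> // -[|j] lt_j /=; first by rewrite addn0 w0.
    by rewrite -addSnnS; apply: Hw.
  case=> w [w0 Hw] ->; exists (st s c i.+1 (w 1)).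
    by apply/Hbody; exists (w 1) => //; rewrite -w0; have := Hw 0 isT; rewrite addn0.
  apply/IH; exists (fun j => w j.+1); last by rewrite addSnnS.
  by split=> // j lt_j; rewrite addSnnS; apply: Hw.
have lt0 := lt_a 0 isT.
have HF' m : exec F s m <-> exists2 y, murec_eval f rest y & m = st s 0 0 y.
  rewrite HF; [|by move=> *; rewrite s0 //; lia|by rewrite s0 //; lia].
  rewrite arest; suff e y : upd s t.+2 y = st s 0 0 y.
    by split=> -[y Hy ->]; exists y; rewrite ?e.
  apply: functional_extensionality => r; rewrite /upd /st.
  by regs; rewrite s0 //; lia.
have Hcopy u m : exec (copy (a 0) t t.+4) (st s 0 0 u) m <->
    m = st s (s (a 0)) 0 u.
  rewrite exec_copy; try lia.
    suff -> : upd (st s 0 0 u) t (st s 0 0 u t + st s 0 0 u (a 0))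
      = st s (s (a 0)) 0 u by [].
    apply: functional_extensionality => r; rewrite /upd /st.
    by regs.
  by rewrite /st; regs; rewrite s0 //; lia.
have x2 : t.+2 \notin [:: o] by rewrite inE; lia.
have Hend i u m : exec (Seq (drain t.+2 [:: o]) (drain t.+1 [::])) (st s 0 i u) m
    <-> m = upd s o u.
  have e : (fun r => if r == t.+1 then 0 else (fun r => if r == t.+2 then 0 else
      if r \in [:: o] then st s 0 i u r + st s 0 i u t.+2 else st s 0 i u r) r)
      = upd s o u.
    apply: functional_extensionality => r; rewrite /upd /st !inE.
    by regs; rewrite s0 //; lia.
  split=> [/exec_seq [m1 /exec_drain-/(_ isT x2) -> /exec_drain-/(_ isT isT) -> //]|->].
  apply/exec_seq; eexists; first by rewrite exec_drain.
  by rewrite exec_drain.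
have hv : thead v = s (a 0) by exact: thead_args.
split.
  case/exec_seq=> m1 /HF' [u Hu ->] /exec_seq [m2 /Hcopy ->].
  case/exec_seq=> m3 /Hloop [w [w0 Hw] ->] /Hend ->.
  exists (w (s (a 0))); last by [].
  by exists w; rewrite hv w0.
case=> y [w [w0 Hw ->]] ->; rewrite hv in Hw *.
apply/exec_seq; exists (st s 0 0 (w 0)); first by apply/HF'; exists (w 0).
apply/exec_seq; exists (st s (s (a 0)) 0 (w 0)); first exact/Hcopy.
apply/exec_seq; exists (st s 0 (s (a 0)) (w (s (a 0)))); last exact/Hend.
by apply/Hloop; exists w.
Qed.

Lemma compile_mu n (f : murec n.+1) : compilable f -> compilable (MMu f).
Proof.
move=> Cf a o t lt_a ne_a lt_o.
(* [t] holds the candidate and [t + 1] the value of [f] on it, which is also the loop register: the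
   search goes on while it is nonzero. *)
pose st (s : store) i u : store := fun r =>
  if r == t then i else if r == t.+1 then u else s r.
have [|||F HF] := Cf (scons t a) t.+1 t.+2; try lia.
- by case=> [|i] lt_i /=; try lia; have := lt_a i; lia.
- by case=> [|i] lt_i /=; try lia; have := lt_a i; lia.
pose body := Seq (drain t.+1 [::]) (Seq (Atom (Inc t)) F).
exists (Seq F (Seq (loop t.+1 body) (drain t [:: o]))) => s s' s0 so.
set v := args n _.
have HF' i m : exec F (st s i 0) m <->
    exists2 y, murec_eval f [tuple of i :: v] y & m = st s i y.
  have e y : upd (st s i 0) t.+1 y = st s i y.
    apply: functional_extensionality => r; rewrite /upd /st.
    by regs.
  rewrite HF.
  - rewrite (_ : args _ _ = [tuple of i :: v]).
      by split=> -[y Hy ->]; exists y; rewrite ?e.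
    rewrite cons_args; apply: eq_args => -[|j] lt_j; rewrite /= /st ?eqxx //.
    by have := lt_a j lt_j; do !case: eqP; lia.
  - by move=> r le_r; rewrite /st; regs; rewrite s0 //; lia.
  - by rewrite /st; regs.
have Hbody i u m : exec body (st s i u) m <->
    exists2 y, murec_eval f [tuple of i.+1 :: v] y & m = st s i.+1 y.
  have e : upd (fun r => if r == t.+1 then 0 else st s i u r) t
      ((fun r => if r == t.+1 then 0 else st s i u r) t).+1 = st s i.+1 0.
    apply: functional_extensionality => r; rewrite /upd /st.
    by regs.
  split.
    case/exec_seq=> m1 /exec_drain-/(_ isT isT) -> /exec_seq [m2 /exec_inc ->].
    by rewrite e => /HF'.
  move=> H; apply/exec_seq; eexists; first by rewrite exec_drain.
  by apply/exec_seq; eexists; [exact/exec_inc | rewrite e; apply/HF'].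
have stq i u : st s i u t.+1 = u by rewrite /st; regs.
have e_dec i u : upd (st s i u.+1) t.+1 u = st s i u.
  apply: functional_extensionality => r; rewrite /upd /st.
  by regs.
(* The body overwrites the loop register, so the store does not reveal the number of rounds; the
   induction is on the run itself. *)
have Hsound i u m : murec_eval f [tuple of i :: v] u ->
    exec (loop t.+1 body) (st s i u) m -> exists y, [/\ m = st s y 0,
      murec_eval f [tuple of y :: v] 0
      & forall z, i <= z < y -> exists k, murec_eval f [tuple of z :: v] k.+1].
  move=> Hu /exec_seq [m1 run /exec_tz [m1q ->]].
  move: run (erefl (st s i u)); move: {1 3}(st s i u) => x run.
  elim: run i u Hu m1q => {x m1 m} [x|x y z].
    move=> i u Hu xq e; rewrite -e stq in xq; exists i; rewrite -e xq in Hu *.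
    by split=> // z; lia.
  case=> m /exec_dec [x_gt0 ->] ex _ IH i u Hu zq e.
  move: x_gt0 ex; rewrite -e stq; case: u Hu {e} => // u Hu _.
  rewrite e_dec => /Hbody [y' Hy' ey].
  have [w [-> Hw Hlt]] := IH _ _ Hy' zq (esym ey).
  exists w; split=> // r /andP [le_ir lt_rw].
  have [er|ne] := eqVneq i r; first by exists u; rewrite -er.
  by apply: Hlt; lia.
(* Here the number of rounds is known: [d] is the distance from the candidate to the least zero. *)
have Hcompl d i u y : i + d = y -> murec_eval f [tuple of i :: v] u ->
    murec_eval f [tuple of y :: v] 0 ->
    (forall z, z < y -> exists k, murec_eval f [tuple of z :: v] k.+1) ->
    exec (loop t.+1 body) (st s i u) (st s y 0).
  move=> + + Hy Hlt; elim: d i u => [|d IH] i u e Hu.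
    move: Hu; rewrite -(addn0 i) e => /(murec_eval_functional Hy) <-.
    by rewrite exec_loop0.
  have [|k Hk] := Hlt i; first lia.
  rewrite (murec_eval_functional Hu Hk) (@exec_loopS _ _ _ _ k) // e_dec.
  have [u' Hu'] : exists u', murec_eval f [tuple of i.+1 :: v] u'.
    case: (ltngtP i.+1 y) => [lt|?|->]; [|lia|by exists 0].
    by have [k' Hk'] := Hlt _ lt; exists k'.+1.
  exists (st s i.+1 u'); first by apply/Hbody; exists u'.
  by apply: IH => //; lia.
have x0 : t \notin [:: o] by rewrite inE; lia.
have Hend y m : exec (drain t [:: o]) (st s y 0) m <-> m = upd s o y.
  rewrite exec_drain //; suff -> : (fun r => if r == t then 0 else
    if r \in [:: o] then st s y 0 r + st s y 0 t else st s y 0 r) = upd s o y by [].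
  apply: functional_extensionality => r; rewrite /upd /st !inE.
  by regs; rewrite s0 //; lia.
have es : s = st s 0 0.
  apply: functional_extensionality => r; rewrite /st.
  by regs; rewrite s0 //; lia.
split.
  rewrite {1}es => /exec_seq [m1 /HF' [u Hu ->] /exec_seq [m2 /(Hsound _ _ _ Hu)]].
  by case=> y [-> Hy Hlt] /Hend ->; exists y.
case=> y [Hy Hlt] ->.
have [u Hu] : exists u, murec_eval f [tuple of 0 :: v] u.
  by case: y Hy Hlt => [|y] Hy Hlt; [exists 0|have [k] := Hlt 0 isT; exists k.+1].
apply/exec_seq; exists (st s 0 u); first by rewrite {1}es; apply/HF'; exists u.
apply/exec_seq; exists (st s y 0); last exact/Hend.
exact: (Hcompl y).
Qed.

Lemma murec_compilable n (p : murec n) : compilable p.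
Proof.
elim: p => {n} *; [exact: compile_zero | exact: compile_succ
  | exact: compile_proj | exact: compile_comp | exact: compile_prec
  | exact: compile_mu].
Qed.

Definition input_store n : store := fun r => if r == 0 then n else 0.

Lemma murec_program (h : murec 1) : exists P, forall n,
  (exists s', exec P (input_store n) s') <->
  (exists y, murec_eval h [tuple n] y).
Proof.
have [|||P HP] := murec_compilable h (a := fun=> 0) (o := 1) (t := 2) => //.
have HP' n s' : exec P (input_store n) s' <->
    exists2 y, murec_eval h [tuple n] y & s' = upd (input_store n) 1 y.
  have <- : args 1 (fun=> n) = [tuple n].
    by apply: eq_from_tnth => i; rewrite tnth_mktuple ord1.
  by rewrite HP // => -[].
exists P => n; split=> [[s' /HP' [y Hy _]]|[y Hy]]; first by exists y.
by exists (upd (input_store n) 1 y); apply/HP'; exists y.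
Qed.

(** * Routing paths as relations *)

Section RoutingPaths.
Context (tau : vocabulary) (G : graph tau).
Implicit Types (R : routing tau) (x y : node G).

Lemma word_path_cat w1 w2 x y :
  word_path (w1 ++ w2) x y <-> exists2 d, word_path w1 x d & word_path w2 d y.
Proof.
elim: w1 x => [|l w1 IH] x /=; first by split=> [|[d ->]] //; exists x.
split=> [[d [xd /IH [e de ey]]]|[e [d [xd de]] ey]].
  by exists e => //; exists d.
by exists d; split=> //; apply/IH; exists e.
Qed.

Lemma path_eps x y : routing_path REps x y <-> x = y.
Proof. by split=> [[w [-> //]]|->]; exists [::]. Qed.

Lemma path_letter l x y : routing_path (RLetter l) x y <-> letter_path l x y.
Proof.
split=> [[w [-> [d [xd <-]]]] //|xy]; exists [:: l]; split=> //.
by exists y.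
Qed.

Lemma path_cat R1 R2 x y : routing_path (RCat R1 R2) x y <->
  exists2 d, routing_path R1 x d & routing_path R2 d y.
Proof.
split=> [[w [[w1 [w2 [L1 L2 ->]]] /word_path_cat [d p1 p2]]]|].
  by exists d; [exists w1 | exists w2].
case=> d [w1 [L1 p1]] [w2 [L2 p2]]; exists (w1 ++ w2); split.
  by exists w1, w2.
by apply/word_path_cat; exists d.
Qed.

Lemma path_alt R1 R2 x y : routing_path (RAlt R1 R2) x y <->
  routing_path R1 x y \/ routing_path R2 x y.
Proof.
split=> [[w [[L|L] p]]|[[w [L p]]|[w [L p]]]].
- by left; exists w.
- by right; exists w.
- by exists w; split=> //; left.
- by exists w; split=> //; right.
Qed.

Lemma path_star R x y :
  routing_path (RStar R) x y <-> star (routing_path R) x y.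
Proof.
split=> [[w [L p]]|].
  elim: L x p => {w} [|w1 w2 L1 _ IH] x /=; first by move=> ->; exact: StarRefl.
  by case/word_path_cat=> d p1 /IH; apply: StarStep; exists w1.
elim=> {x y} [x|x d y [w1 [L1 p1]] _ [w2 [L2 p2]]].
  by exists [::]; split=> //; exact: StarNil.
exists (w1 ++ w2); split; first exact: StarCat.
by apply/word_path_cat; exists d.
Qed.

End RoutingPaths.

Lemma star_snoc T (r : T -> T -> Prop) x y z : star r x y -> r y z -> star r x z.
Proof.
elim=> {x y} [x|x d y xd _ IH] yz; last exact: StarStep xd (IH yz).
exact: StarStep yz (StarRefl _ _).
Qed.

(** * Programs as routing expressions *)

Definition tau := std_vocabulary 1 2.

(* The node reached from the origin by t right-edges and v up-edges stands for
   the value v at time t. The unary symbol 0 marks the value 0, and the symbol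
   r + 1 marks the value of register r. *)
Definition origin : cst tau := ord0 : 'I_1.
Definition right : lab tau := ord0 : 'I_2.
Definition up : lab tau := ord_max : 'I_2.

Definition goR : routing tau := RLetter (Fwd right).
Definition goL : routing tau := RLetter (Bwd right).
Definition goU : routing tau := RLetter (Fwd up).
Definition goD : routing tau := RLetter (Bwd up).
Definition test (u : nat) : routing tau := RLetter (Una (u : una tau)).

(** A constraint speaks only about nodes routed from the constant and their neighbors, so the grid
    conditions are imposed on this region, which contains every cell. *)
Definition near : routing tau := RStar (RAlt goR goU).

Definition optional (b : bool) (R : routing tau) := if b then R else REps.

Definition climb : routing tau := RStar (RCat goU (RCat goL goR)).

(* A round trip from the foot of column t + 1: at some common height v, register
   r is v + a in column t and v + b in column t + 1. While climbing, the detours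
   to column t keep the two columns aligned. *)
Definition check (a b z : bool) (r : nat) : routing tau :=
  RCat (optional (~~ z) climb) (RCat goL (RCat (optional a goU)
    (RCat (test r.+1) (RCat (optional a goD) (RCat goR (RCat (optional b goU)
      (RCat (test r.+1) (RCat (RStar goD) (test 0))))))))).

Definition rcat (Rs : seq (routing tau)) := foldr (@RCat tau) REps Rs.

(** The mark 0 demanded at the foot of the new column is what makes the descent closing each check
    stop exactly there. *)
Definition enc_instr k i := RCat goR (RCat (test 0)
  (rcat [seq check (pre i r) (post i r) (tz i r) r | r <- iota 0 k])).

Fixpoint enc k P : routing tau :=
  match P with
  | Skip => REps
  | Atom i => enc_instr k i
  | Seq P Q => RCat (enc k P) (enc k Q)
  | Star P => RStar (enc k P)
  end.

Definition reg i := match i with Inc q | Dec q | Tz q => q end.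

Fixpoint width P :=
  match P with
  | Skip => 0
  | Atom i => (reg i).+1
  | Seq P Q => maxn (width P) (width Q)
  | Star P => width P
  end.

Definition twice r : routing tau :=
  RCat near (RCat (test r.+1) (RCat (RCat goU (RStar goU)) (test r.+1))).

(** No field makes the grid extend: the cells in use exist because the routed path visits them.
    [grid_square] only carries an up-edge over to the column on its left. *)
Record gridlike (G : graph tau) : Prop := Gridlike {
  grid_fun : forall f x a b, routing_path near (icst G origin) x ->
    edge f x a -> edge f x b -> a = b;
  grid_inj : forall f x a b, routing_path near (icst G origin) x ->
    edge f a x -> edge f b x -> a = b;
  grid_square : forall x x' y y', routing_path near (icst G origin) x' ->
    edge right x x' -> edge right y y' -> edge up x' y' -> edge up x y;
  grid_foot : forall x y, routing_path near (icst G origin) y ->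
    edge up x y -> ~ iuna (0 : una tau) y }.

(** * From paths to executions *)

Section Soundness.
Context (G : graph tau).
Implicit Types x y : node G.

Fixpoint foot t b : Prop :=
  if t is t'.+1 then exists2 b', foot t' b' & edge right b' b
  else b = icst G origin.

Fixpoint cell t v x : Prop :=
  if v is v'.+1 then exists2 y, cell t v' y & edge up y x else foot t x.

Definition holds t r v := exists2 x, cell t v x & iuna (r.+1 : una tau) x.

Lemma near_cell t v x : cell t v x -> routing_path near (icst G origin) x.
Proof.
have stp f y z : f = right \/ f = up -> routing_path near (icst G origin) y ->
    edge f y z -> routing_path near (icst G origin) z.
  move=> Hf /path_star st e; apply/path_star; apply: star_snoc st _.
  by apply/path_alt; case: Hf e => -> e; [left | right]; apply/path_letter.
elim: v x => [|v IH] x /=.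
  elim: t x => [|t IH] x /=; first by move=> ->; apply/path_star; exact: StarRefl.
  by case=> y /IH; apply: stp; left.
by case=> y /IH; apply: stp; right.
Qed.


Context (gG : gridlike G).

Lemma foot_fun t x y : foot t x -> foot t y -> x = y.
Proof.
elim: t x y => [|t IH] x y /=; first by move=> -> ->.
case=> x' fx ex [y' fy ey]; rewrite -(IH _ _ fx fy) in ey.
exact: (grid_fun gG (@near_cell t 0 _ fx) ex ey).
Qed.

Lemma cell_fun t v x y : cell t v x -> cell t v y -> x = y.
Proof.
elim: v x y => [|v IH] x y /=; first exact: foot_fun.
case=> x' fx ex [y' fy ey]; rewrite -(IH _ _ fx fy) in ey.
exact: (grid_fun gG (near_cell fx) ex ey).
Qed.

(** Up-edges into a near node have one source, so descending retraces the cells. A cell above the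
    foot has an incoming up-edge, hence no mark 0, and the marked foot has none, so the walk cannot
    pass below it. *)
Lemma descend_sound t b v x y : foot t b -> iuna (0 : una tau) b ->
  cell t v x -> routing_path (RStar goD) x y -> iuna (0 : una tau) y -> y = b.
Proof.
move=> fb b0 cx /path_star st y0; elim: st v cx y0 => {x y} [x|x d y xd _ IH] v.
  case: v => [|v] cx x0; first exact: foot_fun cx fb.
  by case: (cx) => y _ e; case: (grid_foot gG (near_cell cx) e).
move/path_letter: xd => /= dx; case: v => [|v] cx.
  rewrite (foot_fun cx fb) in dx.
  by case: (grid_foot gG (@near_cell t 0 _ fb) dx b0).
case: (cx) => d' cd' d'x; apply: (IH v).
by rewrite (grid_inj gG (near_cell cx) dx d'x).
Qed.

(** Each detour exhibits a left neighbor of the new node; by the square condition it lies directly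
    above the previous left neighbor, so both columns gain the same height. *)
Lemma climb_sound t x y v w : cell t v w -> edge right w x -> cell t.+1 v x ->
  routing_path climb x y ->
  exists v' w', [/\ cell t v' w', edge right w' y & cell t.+1 v' y].
Proof.
move=> + + + /path_star st; elim: st v w => {x y} [x|x d y st _ IH] v w cw wx cx.
  by exists v, w.
case/path_cat: st => x2 /path_letter /= xx2.
case/path_cat=> w2 /path_letter /= w2x2 /path_letter /= w2d.
have ww2 := grid_square gG (near_cell cx) wx w2x2 xx2.
have cw2 : cell t v.+1 w2 by exists w.
apply: (IH v.+1 w2) => //; exists x => //.
by rewrite (grid_fun gG (near_cell cw2) w2d w2x2).
Qed.

Lemma check_sound a b z r t w x y : foot t w -> edge right w x ->
  iuna (0 : una tau) x -> routing_path (check a b z r) x y ->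
  y = x /\ exists v, [/\ holds t r (v + a), holds t.+1 r (v + b) & z -> v = 0].
Proof.
move=> fw wx x0 /path_cat [x1 p1].
have fx : foot t.+1 x by exists w.
(* [v] is the height reached by the climb; a zero test omits the climb, which leaves [v = 0]. *)
have {p1} [v [w1 [cw1 w1x1 cx1 zv]]] : exists v w1,
    [/\ cell t v w1, edge right w1 x1, cell t.+1 v x1 & z -> v = 0].
  case: z p1 => /= [/path_eps <-|]; first by exists 0, w.
  by case/(@climb_sound t _ _ 0 w) => // v [w1 [? ? ?]]; exists v, w1.
case/path_cat=> w1' /path_letter /= e.
rewrite {w1' e}(grid_inj gG (near_cell cx1) e w1x1).
case/path_cat=> w2 p2 /path_cat [w2' /path_letter [<- Vw2]].
have cw2 : cell t (v + a) w2.
  case: a p2 => /= [/path_letter /= e|/path_eps <-]; last by rewrite addn0.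
  by rewrite addn1; exists w1.
case/path_cat=> w3 p3.
have -> : w3 = w1.
  case: a p2 p3 cw2 => /= [/path_letter /= e /path_letter /= e'|].
    by move=> cw2; exact: (grid_inj gG (near_cell cw2) e' e).
  by move=> /path_eps -> /path_eps ->.
case/path_cat=> x2 /path_letter /= e.
rewrite {x2 e}(grid_fun gG (near_cell cw1) e w1x1).
case/path_cat=> x3 p4 /path_cat [x3' /path_letter [<- Vx3]].
have cx3 : cell t.+1 (v + b) x3.
  case: b p4 => /= [/path_letter /= e|/path_eps <-]; last by rewrite addn0.
  by rewrite addn1; exists x1.
case/path_cat=> y' p5 /path_letter [<- y0].
split; first exact: descend_sound fx x0 cx3 p5 y0.
by exists v; split=> //; [exists w2 | exists x3].
Qed.

Lemma checks_sound (a b z : nat -> bool) rs t w x y : foot t w ->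
  edge right w x -> iuna (0 : una tau) x ->
  routing_path (rcat [seq check (a r) (b r) (z r) r | r <- rs]) x y ->
  y = x /\ forall r, r \in rs -> exists v,
    [/\ holds t r (v + a r), holds t.+1 r (v + b r) & z r -> v = 0].
Proof.
move=> fw wx x0; elim: rs => [|r rs IH] /=; first by move=> /path_eps.
case/path_cat=> x' /(check_sound fw wx x0) [-> Hr] /IH [-> Hrs].
by split=> // q; rewrite inE => /predU1P [-> //|/Hrs].
Qed.

Context (k : nat).
Context (once : forall r x, r < k -> ~ routing_path (twice r) (icst G origin) x).

(** Two marks at different heights of one column would yield a route of [twice r], from the lower
    mark up to the higher one. *)
Lemma holds_fun t r v v' : r < k -> holds t r v -> holds t r v' -> v = v'.
Proof.
move=> lt_r; wlog lt_v : v v' / v < v'.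
  by move=> W h h'; case: (ltngtP v v') => // lt; [exact: W | apply/esym; exact: W].
case=> x cx Vx [y cy Vy]; case: (once (x := y) lt_r).
apply/path_cat; exists x; first exact: near_cell cx.
apply/path_cat; exists x; first exact/path_letter.
apply/path_cat; exists y; last exact/path_letter.
elim: v' lt_v y cy {Vy} => // v' IH lt_v y [d cd dy].
have [lt|ge] := ltnP v v'.
  case/path_cat: (IH lt d cd) => e xe /path_star ed.
  apply/path_cat; exists e => //; apply/path_star; apply: star_snoc ed _.
  exact/path_letter.
have e : v' = v by lia.
apply/path_cat; exists y; last by apply/path_star; exact: StarRefl.
by apply/path_letter; rewrite (cell_fun cx (y := d)) // -e.
Qed.

Definition represents t (s : store) := forall r, r < k -> holds t r (s r).

Lemma enc_instr_sound i t b b' s : reg i < k -> foot t b -> represents t s ->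
  routing_path (enc_instr k i) b b' ->
  exists s', [/\ step i s s', foot t.+1 b' & represents t.+1 s'].
Proof.
move=> lt_i fb rs /path_cat [b1 /path_letter /= bb1].
case/path_cat=> b2 /path_letter [<- b10] /(checks_sound fb bb1 b10) [-> H].
(* Uniqueness of marks turns the mark seen by the check at time [t] into an equation for [s r]. *)
have {}H r : r < k -> exists v, [/\ s r = v + pre i r,
    holds t.+1 r (v + post i r) & tz i r -> v = 0].
  move=> lt_r; have [|v [h h' hz]] := H r; first by rewrite mem_iota.
  by exists v; split=> //; exact: holds_fun (rs r lt_r) h.
(* The subtraction is exact on checked registers. From [k] on, the instruction acts trivially, so
   the store is unchanged there. *)
exists (fun r => s r - pre i r + post i r); split.
- move=> r; have [lt_r|ge_r] := ltnP r k.
    by have [v [-> _ hz]] := H r lt_r; exists v; rewrite addnK.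
  exists (s r).
  suff [-> -> ->] : [/\ pre i r = false, post i r = false & tz i r = false].
    by rewrite subn0 !addn0.
  by case: i lt_i {H} => q /= lt_q; split=> //; lia.
- by exists b.
- by move=> r lt_r; have [v [-> hv _]] := H r lt_r; rewrite addnK.
Qed.

Lemma enc_sound P t b b' s : width P <= k -> foot t b -> represents t s ->
  routing_path (enc k P) b b' ->
  exists t' s', [/\ exec P s s', foot t' b' & represents t' s'].
Proof.
elim: P t b b' s => [|i|P IHP Q IHQ|P IH] t b b' s /= wP fb rs.
- by move/path_eps=> <-; exists t, s.
- by case/(enc_instr_sound wP fb rs) => s' [st f' r']; exists t.+1, s'.
- move: wP; rewrite geq_max => /andP [wP wQ] /path_cat [d].
  case/(IHP _ _ _ _ wP fb rs) => t1 [s1 [ex1 f1 r1]].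
  case/(IHQ _ _ _ _ wQ f1 r1) => t2 [s2 [ex2 f2 r2]].
  by exists t2, s2; split=> //; exists s1.
- move/path_star=> st; elim: st t s fb rs => {b b'} [b|b d b' bd _ IHs] t s fb rs.
    by exists t, s; split=> //; exact: StarRefl.
  have [t1 [s1 [ex1 f1 r1]]] := IH _ _ _ _ wP fb rs bd.
  have [t2 [s2 [ex2 f2 r2]]] := IHs _ _ f1 r1.
  by exists t2, s2; split=> //; exact: StarStep ex1 ex2.
Qed.

End Soundness.

(** * From executions to paths *)

(** The intended model, with [h t] the store at time [t]. *)
Definition grid (h : nat -> store) : graph tau := @Graph tau (nat * nat)%type
  (fun f p q => q = if f == right then (p.1.+1, p.2) else (p.1, p.2.+1))
  (fun=> (0, 0))
  (fun u p => p.2 = if (u : nat) is r.+1 then h p.1 r else 0).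

Section Completeness.
Context (h : nat -> store).
Let G := grid h.

Lemma grid_goR t v : @routing_path tau G goR (t, v) (t.+1, v).
Proof. exact/path_letter. Qed.

Lemma grid_goL t v : @routing_path tau G goL (t.+1, v) (t, v).
Proof. exact/path_letter. Qed.

Lemma grid_goU t v : @routing_path tau G goU (t, v) (t, v.+1).
Proof. exact/path_letter. Qed.

Lemma grid_goD t v : @routing_path tau G goD (t, v.+1) (t, v).
Proof. exact/path_letter. Qed.

Lemma grid_test t v r : v = h t r -> @routing_path tau G (test r.+1) (t, v) (t, v).
Proof. by move=> e; apply/path_letter. Qed.

Lemma grid_climb t v : @routing_path tau G climb (t.+1, 0) (t.+1, v).
Proof.
apply/path_star; elim: v => [|v IH]; first exact: StarRefl.
apply: star_snoc IH _; apply/path_cat; exists (t.+1, v.+1); first exact: grid_goU.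
by apply/path_cat; exists (t, v.+1); [exact: grid_goL | exact: grid_goR].
Qed.

Lemma grid_descend t v : @routing_path tau G (RStar goD) (t, v) (t, 0).
Proof.
apply/path_star; elim: v => [|v IH]; first exact: StarRefl.
by apply: StarStep IH; exact: grid_goD.
Qed.

Lemma grid_check (a b z : bool) r t v : h t r = v + a -> h t.+1 r = v + b ->
  (z -> v = 0) -> @routing_path tau G (check a b z r) (t.+1, 0) (t.+1, 0).
Proof.
move=> ha hb hz; apply/path_cat; exists (t.+1, v).
  by case: z hz => [->|_] //=; [apply/path_eps | exact: grid_climb].
apply/path_cat; exists (t, v); first exact: grid_goL.
apply/path_cat; exists (t, v + a).
  by case: {ha} a; rewrite ?addn1 ?addn0; [exact: grid_goU | apply/path_eps].
apply/path_cat; exists (t, v + a); first exact: grid_test.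
apply/path_cat; exists (t, v).
  by case: {ha} a; rewrite ?addn1 ?addn0; [exact: grid_goD | apply/path_eps].
apply/path_cat; exists (t.+1, v); first exact: grid_goR.
apply/path_cat; exists (t.+1, v + b).
  by case: {hb} b; rewrite ?addn1 ?addn0; [exact: grid_goU | apply/path_eps].
apply/path_cat; exists (t.+1, v + b); first exact: grid_test.
apply/path_cat; exists (t.+1, 0); first exact: grid_descend.
exact/path_letter.
Qed.

Lemma grid_instr k i t : step i (h t) (h t.+1) ->
  @routing_path tau G (enc_instr k i) (t, 0) (t.+1, 0).
Proof.
move=> st; apply/path_cat; exists (t.+1, 0); first exact: grid_goR.
apply/path_cat; exists (t.+1, 0); first exact/path_letter.
elim: (iota 0 k) => [|r rs IH] /=; first exact/path_eps.
apply/path_cat; exists (t.+1, 0) => //; have [v [ha hb hz]] := st r.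
exact: grid_check ha hb hz.
Qed.

End Completeness.

(** [l] lists the stores after [s], one per column. Allowing any [h] that agrees with the trace on
    its own columns lets consecutive traces share one grid. *)
Definition traced (R : routing tau) s s' := exists2 l, last s l = s' &
  forall h t, (forall i, i <= size l -> h (t + i) = nth s (s :: l) i) ->
  @routing_path tau (grid h) R (t, 0) (t + size l, 0).

Lemma traced_cat R1 R2 s m s' :
  traced R1 s m -> traced R2 m s' -> traced (RCat R1 R2) s s'.
Proof.
move=> [l1 e1 H1] [l2 e2 H2]; exists (l1 ++ l2); first by rewrite last_cat e1.
move=> h t H; apply/path_cat; exists (t + size l1, 0).
  apply: H1 => i le_i; rewrite H ?size_cat; last lia.
  by rewrite -cat_cons nth_cat /= ltnS le_i.
rewrite size_cat addnA; apply: H2 => i le_i.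
rewrite -addnA H ?size_cat; last lia.
(* Index 0 is the shared store, last in the first trace and head of the second. *)
case: i le_i => [|i] le_i.
  by rewrite addn0 -cat_cons nth_cat /= ltnSn -e1 -last_nth.
by rewrite addnS /= nth_cat ltnNge leq_addr addKn /=; exact: set_nth_default.
Qed.

Lemma traced_star R s s' : star (traced R) s s' -> traced (RStar R) s s'.
Proof.
elim=> {s s'} [s|s m s' sm _ ms'].
  by exists [::] => // h t _; rewrite addn0; apply/path_star; exact: StarRefl.
have [l el H] := traced_cat sm ms'; exists l => // h t /H.
case/path_cat=> d p /path_star q; apply/path_star; exact: StarStep p q.
Qed.

Lemma star_mono T (r r' : T -> T -> Prop) x y :
  (forall x y, r x y -> r' x y) -> star r x y -> star r' x y.
Proof.
move=> rr'; elim=> {x y} [x|x d y /rr' xd _]; first exact: StarRefl.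
exact: StarStep.
Qed.

Lemma enc_complete k P s s' : exec P s s' -> traced (enc k P) s s'.
Proof.
elim: P s s' => [|i|P IHP Q IHQ|P IH] s s' /=.
- by move=> ->; exists [::] => // h t _; rewrite addn0; apply/path_eps.
- move=> st; exists [:: s'] => // h t H /=; rewrite addn1; apply: grid_instr.
  by have := H 1 isT; have := H 0 isT; rewrite /= addn0 addn1 => -> ->.
- by case=> m /IHP + /IHQ; exact: traced_cat.
- by move/(star_mono IH); exact: traced_star.
Qed.

(** * The formula *)

Definition falsum : qf tau := QNot (QEq (TVar 0) (TVar 0)).

(** With a contradictory pattern the constraint fails as soon as any node is reached; its negation
    thus asserts that a path exists. *)
Definition never (R : routing tau) : LRP tau :=
  LReach (@ReachConstraint tau origin R [::] falsum isT).

Definition f_fun f : LRP tau := LReach (@ReachConstraint tau origin near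
  [:: (0, f, 1); (0, f, 2)] (QEq (TVar 1) (TVar 2)) isT).

Definition f_inj f : LRP tau := LReach (@ReachConstraint tau origin near
  [:: (1, f, 0); (2, f, 0)] (QEq (TVar 1) (TVar 2)) isT).

Definition f_square : LRP tau := LReach (@ReachConstraint tau origin near
  [:: (1, right, 0); (2, right, 3); (0, up, 3)] (QEdge up (TVar 1) (TVar 2)) isT).

Definition f_foot : LRP tau := LReach (@ReachConstraint tau origin near
  [:: (1, up, 0)] (QNot (QUna (0 : una tau) (TVar 0))) isT).

Definition f_grid := LAnd (LAnd (LAnd (f_fun right) (f_fun up))
  (LAnd (f_inj right) (f_inj up))) (LAnd f_square f_foot).

(* LRP has no constant "true"; f_foot is implied by f_grid. *)
Fixpoint f_once k := if k is k'.+1 then LAnd (never (twice k')) (f_once k')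
  else f_foot.

Definition init k := rcat [seq test r.+1 | r <- iota 1 k].

(** Registers 0 to [width P] are tracked, so the input register 0 is present even when the width is
    0. [init] fixes all of them but register 0, left to [f_input]. *)
Definition f_prog P : LRP tau := let k := width P in
  LAnd f_grid (LAnd (f_once k.+1) (LNot (never (RCat (init k) (enc k.+1 P))))).

Definition input_route n : routing tau := iter n (RCat goU) (test 1).

Definition f_input n : LRP tau := LNot (never (input_route n)).

Lemma sat_never G R : LRP_sat G (never R) <->
  forall x, ~ routing_path R (icst G origin) x.
Proof.
split=> [H x p|H s p _]; last by case: (H (s 0)).
exact: (H (fun=> x)).
Qed.

Lemma sat_ever G R : LRP_sat G (LNot (never R)) <->
  exists x, routing_path R (icst G origin) x.
Proof.
rewrite -[LRP_sat _ _]/(~ LRP_sat G (never R)) sat_never.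
by split=> [/not_all_not_ex|[x p] /(_ x)].
Qed.

Lemma label_cases (f : lab tau) : f = right \/ f = up.
Proof. by case: f => -[|[|//]] lt; [left|right]; exact: val_inj. Qed.

Lemma sat_grid G : LRP_sat G f_grid -> gridlike G.
Proof.
case=> -[[fr fu] [ir iu]] [sq ft].
(* The default [d] of [nth] is the value of variable 3, needed for the fourth corner of the
   square. *)
pose sub x a b d : nat -> node G := nth d [:: x; a; b].
split=> [f x a b nx|f x a b nx|x x' y y' nx|x y ny] *.
- have F : LRP_sat G (f_fun f) by case: (label_cases f) => ->.
  exact: (F (sub x a b x)).
- have F : LRP_sat G (f_inj f) by case: (label_cases f) => ->.
  exact: (F (sub x a b x)).
- exact: (sq (sub x' x y y')).
- exact: (ft (sub y x x x)).
Qed.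

Lemma sat_once G k : LRP_sat G (f_once k) ->
  forall r x, r < k -> ~ routing_path (twice r) (icst G origin) x.
Proof.
elim: k => // k IH [/sat_never H /IH Hk] r x.
by rewrite ltnS leq_eqVlt => /orP [/eqP ->|/Hk].
Qed.

Lemma grid_sat h : LRP_sat (grid h) f_grid.
Proof.
have U : up == right = false by [].
split; first split; split=> s _ /=; rewrite ?eqxx ?U.
- by case=> -> [->].
- by case=> -> [->].
- by case: (s 1) (s 2) => [a b] [a' b'] /= [-> [[-> ->]]].
- by case: (s 1) (s 2) => [a b] [a' b'] /= [-> [[-> ->]]].
- case: (s 0) (s 1) (s 2) (s 3) => [? ?] [? ?] [? ?] [? ?] /=.
  by case=> [[-> ->]] [[-> ->]] [[-> ->]].
- by case=> ->.
Qed.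

(** Going up keeps the column and strictly increases the height, whereas column [t] has the mark of
    [r] only at height [h t r]. *)
Lemma grid_once h k : LRP_sat (grid h) (f_once k).
Proof.
elim: k => [|k IH]; first by case: (grid_sat h) => _ [].
split=> //; apply/sat_never => x.
case/path_cat=> -[t v] _ /path_cat [_ /path_letter [<- /= hv]].
case/path_cat=> y /path_cat [z /path_letter /= zE /path_star st].
case/path_letter=> [<- hx].
have [lt e] : v < y.2 /\ y.1 = t.
  have : v < z.2 /\ z.1 = t by rewrite zE.
  elim: st => // a b c /path_letter /= -> _ IHs [lt e].
  by apply: IHs; split=> //=; exact: ltnW.
by rewrite hx e -hv ltnn in lt.
Qed.

Lemma input_sound (G : graph tau) n v (x y : node G) : cell 0 v x ->
  routing_path (input_route n) x y -> holds G 0 0 (v + n).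
Proof.
elim: n v x => [|n IH] v x cx /=.
  by move/path_letter=> [<- Vx]; rewrite addn0; exists x.
case/path_cat=> z /path_letter /= xz p; rewrite -addSnnS; apply: IH p.
by exists x.
Qed.

Lemma grid_input h n v : h 0 0 = v + n ->
  @routing_path tau (grid h) (input_route n) (0, v) (0, v + n).
Proof.
elim: n v => [|n IH] v e /=.
  by rewrite addn0 in e *; apply: grid_test; rewrite e.
apply/path_cat; exists (0, v.+1); first exact: grid_goU.
by rewrite -addSnnS; apply: IH; rewrite addSnnS.
Qed.

Lemma grid_init h k : (forall r, 0 < r -> h 0 r = 0) ->
  @routing_path tau (grid h) (init k) (0, 0) (0, 0).
Proof.
move=> h0; rewrite /init; have : all (leq 1) (iota 1 k).
  by apply/allP => r; rewrite mem_iota => /andP [].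
elim: (iota 1 k) => [|r rs IH] /=; first by move=> _; apply/path_eps.
case/andP=> r_gt0 /IH p; apply/path_cat; exists (0, 0) => //.
by apply: grid_test; rewrite h0.
Qed.

Lemma f_prog_correct P n :
  LRP_satisfiable (LAnd (f_prog P) (f_input n)) <->
  exists s', exec P (input_store n) s'.
Proof.
split.
  set k := width P; case=> G [[sg [so sp]] si].
  have gG : gridlike G := sat_grid sg.
  have once := @sat_once G k.+1 so.
  have [x /path_cat [c pc px]] := iffLR (sat_ever G _) sp.
  have [y py] := iffLR (sat_ever G _) si.
  have h0 : holds G 0 0 n := @input_sound G n 0 _ _ erefl py.
  (* Tests do not move, so the prefix [init] stays at the origin and reads there that registers 1 to
     [k] are 0. *)
  have [ec hr] : c = icst G origin /\ forall r, r \in iota 1 k -> holds G 0 r 0.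
    move: pc; rewrite /init -/k; elim: (iota 1 k) => [|r rs IH] /=.
      by move/path_eps.
    case/path_cat=> d /path_letter [<- Vr] /IH [-> Hrs]; split=> // q.
    by rewrite inE => /predU1P [->|/Hrs //]; exists (icst G origin).
  have rep : represents G k.+1 0 (input_store n).
    by move=> [|r] // lt_r; apply: hr; rewrite mem_iota.
  have [t [s' [ex _ _]]] := enc_sound gG once (leqnSn k) (ec : foot 0 c) rep px.
  by exists s'.
case=> s' ex; have [l _ H] := enc_complete (width P).+1 ex.
pose h t := nth (input_store n) (input_store n :: l) t.
exists (grid h); split; last first.
  by apply/sat_ever; exists (0, n); exact: (@grid_input h n 0).
split; first exact: grid_sat.
split; first exact: grid_once.
apply/sat_ever; exists (0 + size l, 0); apply/path_cat; exists (0, 0).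
  by apply: grid_init => -[].
exact: H.
Qed.

(** * The diagonal argument *)

Definition computable n (f : n.-tuple nat -> nat) :=
  exists p : murec n, forall v, murec_eval p v (f v).

Lemma eq_computable n (f g : n.-tuple nat -> nat) :
  f =1 g -> computable f -> computable g.
Proof. by move=> e [p Hp]; exists p => v; rewrite -e. Qed.

Lemma computable_proj n (i : 'I_n) : computable (fun v => tnth v i).
Proof. by exists (MProj i). Qed.

Lemma computable_comp1 n (F : nat -> nat) (f : n.-tuple nat -> nat) :
  computable (fun w : 1.-tuple nat => F (thead w)) -> computable f ->
  computable (fun v => F (f v)).
Proof.
move=> [P HP] [p Hp]; exists (MComp P (fun=> p)) => v.
exists [tuple f v]; split=> [i|]; first by rewrite ord1.
by have := HP [tuple f v]; rewrite theadE.
Qed.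

Lemma computable_comp2 n (F : nat -> nat -> nat) (f g : n.-tuple nat -> nat) :
  computable (fun w : 2.-tuple nat => F (tnth w ord0) (tnth w ord_max)) ->
  computable f -> computable g -> computable (fun v => F (f v) (g v)).
Proof.
move=> [P HP] [p Hp] [q Hq].
exists (MComp P (fun i => if i == ord0 then p else q)) => v.
exists [tuple f v; g v]; split=> [i|]; last exact: (HP [tuple f v; g v]).
by case: i => -[|[|//]] lt_i.
Qed.

Lemma computable_succ n (f : n.-tuple nat -> nat) :
  computable f -> computable (fun v => (f v).+1).
Proof. by apply: computable_comp1; exists MSucc. Qed.

Lemma computable_const n c : computable (fun _ : n.-tuple nat => c).
Proof.
by elim: c => [|c]; [exists (MZero n) | exact: computable_succ].
Qed.

Lemma computable_rec n (f : n.-tuple nat -> nat) (g : n.+2.-tuple nat -> nat)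
    (F : n.+1.-tuple nat -> nat) :
  computable f -> computable g ->
  (forall v, F v = nat_rect _ (f [tuple of behead v])
    (fun i x => g [tuple of i :: x :: behead v]) (thead v)) ->
  computable F.
Proof.
move=> [p Hp] [q Hq] FE; exists (MPrec p q) => v; rewrite FE.
by exists (nat_rect _ (f [tuple of behead v])
  (fun i x => g [tuple of i :: x :: behead v])); split.
Qed.

Lemma computable_add n (f g : n.-tuple nat -> nat) :
  computable f -> computable g -> computable (fun v => f v + g v).
Proof.
apply: computable_comp2.
apply: (@computable_rec 1 (@thead 0 nat) (fun w => (tnth w (inord 1)).+1)).
- exact: computable_proj.
- exact/computable_succ/computable_proj.
move=> v; have -> : tnth v ord_max = thead [tuple of behead v].
  by rewrite /thead tnth_behead; congr tnth; apply: val_inj; rewrite /= inordK.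
rewrite -[tnth v ord0]/(thead v); elim: (thead v) => // i IH.
by rewrite addSn IH /= (tnth_nth 0) inordK.
Qed.

Lemma computable_rec0 n x0 (G : nat -> nat -> nat) (f : n.-tuple nat -> nat) :
  computable (fun w : 2.-tuple nat => G (tnth w ord0) (tnth w ord_max)) ->
  computable f -> computable (fun v => nat_rect _ x0 G (f v)).
Proof.
move=> CG; apply: computable_comp1.
by apply: (computable_rec (computable_const 0 x0) CG).
Qed.

Lemma computable_cpair n (f g : n.-tuple nat -> nat) :
  computable f -> computable g -> computable (fun v => cpair (f v) (g v)).
Proof.
move=> Cf Cg; have Cfg := computable_add Cf Cg.
suff C : computable (fun v => ((f v + g v) * (f v + g v).+1)./2).
  exact: computable_add C Cg.
apply: (eq_computable
  (f := fun v => nat_rect _ 0 (fun i x => x + i.+1) (f v + g v))).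
  move=> v; elim: (f v + g v) => // i IH; rewrite [LHS]/= IH; apply/esym.
  by rewrite (mulnC i.+1) (mulnC i) -(bin2 i.+2) -(bin2 i.+1) binS bin1.
apply: (@computable_rec0 _ 0 (fun i x => x + i.+1)) => //.
apply: computable_add; first exact: computable_proj.
exact/computable_succ/computable_proj.
Qed.

Definition input_instance (phi : LRP tau) n : LRP_instance :=
  @LRPInstance 1 2 (LAnd phi (f_input n)).

Lemma computable_code_input :
  exists2 g, computable (fun v : 1.-tuple nat => g (thead v)) &
    forall phi n, code_LRP phi = n -> g n = code_instance (input_instance phi n).
Proof.
pose rho := nat_rect (fun=> nat) (code_routing (test 1))
  (fun _ x => cpair 3 (cpair (code_routing goU) x)).
exists (fun n => cpair 1 (cpair 2 (cpair 2 (cpair n (cpair 1 (cpair 0 (cpair 0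
    (cpair (rho n) (cpair 0 (code_qf falsum)))))))))).
  have Cn : computable (@thead 0 nat) by exact: computable_proj.
  have Crho : computable (fun v : 1.-tuple nat => rho (thead v)).
    apply: (@computable_rec0 _ _ (fun _ x =>
      cpair 3 (cpair (code_routing goU) x))) Cn.
    do 2!(apply: computable_cpair; first exact: computable_const).
    exact: computable_proj.
  by do !(apply: computable_cpair => //; try exact: computable_const).
move=> phi n <-; rewrite /code_instance /= /code_rc /=; do !congr cpair.
by elim: (code_LRP phi) => //= k ->.
Qed.

Theorem theorem2 :
  ~ algorithmically_decidable code_instance
      (fun x : LRP_instance => LRP_satisfiable (formula x)).
Proof.
case=> d Hd; have [g [p Hp] gE] := computable_code_input.
pose h : murec 1 := MMu (MComp d (fun=> MComp p (fun=> MProj (ord_max : 'I_2)))).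
have [P HP] := murec_program h.
set e := code_LRP (f_prog P).
have [sat_d unsat_d] := Hd (input_instance (f_prog P) e).
have evalE y z : murec_eval (MComp d (fun=> MComp p (fun=> MProj (ord_max : 'I_2))))
    [tuple y; e] z <-> murec_eval d [tuple g e] z.
  split.
    case=> w [Hw]; suff -> : w = [tuple g e] by [].
    apply: eq_from_tnth => i; rewrite ord1; have [u [Hu pw]] := Hw i.
    have {Hu} ue : u = [tuple e] by apply: eq_from_tnth => j; rewrite ord1 (Hu ord0).
    rewrite ue (ord1 i) in pw.
    exact: (murec_eval_functional pw (Hp [tuple e])).
  move=> dz; exists [tuple g e]; split=> // i; rewrite ord1.
  by exists [tuple e]; split=> [j|]; [rewrite ord1 | exact: (Hp [tuple e])].
have sat_iff : LRP_satisfiable (formula (input_instance (f_prog P) e)) <->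
    murec_eval d [tuple g e] 0.
  rewrite f_prog_correct HP; split=> [[y [/evalE]] //|d0].
  by exists 0; split=> //; apply/evalE.
rewrite -(gE _ _ erefl) -/e in sat_d unsat_d.
have unsat : ~ LRP_satisfiable (formula (input_instance (f_prog P) e)).
  by move=> S; have := murec_eval_functional (sat_d S) (iffLR sat_iff S).
exact/unsat/sat_iff/unsat_d.
Qed.
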